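(* Let $h\in L^2(\mathbb T^2)$. For any $Z=(\Pi,\Gamma)\in\mathcal M(\mathcal T_g^H)$ and any $M^H=M^H(C)$, $C\in\mathbb R$, the pair $M^H(Z)=(\Pi^{M^H},\Gamma^{M^H})$, defined on $T_{\mathcal W^H}\oplus\langle1\rangle$ by $\Pi_z^{M^H}\tau=\Pi_zM^H\tau$, $\Gamma^{M^H}_{zz'}\tau=\Gamma_{zz'}\tau$, can be uniquely extended to an element of $\mathcal M(\mathcal T_g^H)$, and the family of maps $\{M^H(C):C\in\mathbb R\}$ forms a group under composition. Moreover, given $M=M(C)$, $C\in\mathbb R$, and $Z\in\mathcal M(\mathcal T_g)$, $M^H(E_hZ)$ is an admissible model on $\mathcal T_g^H$ and $$M^H(E_hZ)=E_h\,M(Z),$$ where $M^H=M^H(C)$; i.e. the operations of extension and renormalization commute.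
   Context: Notation. Points of $\mathbb R^3=\mathbb R\times\mathbb R^2$ are $z=(t,x)$, with $|z-z'|=\sqrt{|t-t'|}+|x-x'|$; $\varphi_z^\lambda(s,y)=\lambda^{-4}\varphi(\lambda^{-2}(s-t),\lambda^{-1}(y-x))$, $\lambda\in(0,1]$; $\mathcal B$ is the set of $C^2$ functions on $\mathbb R^3$ supported in the unit ball with $C^2$-norm at most $1$. Functions on $\mathbb T^2=(\mathbb R/2\pi\mathbb Z)^2$ are identified with periodic functions on $\mathbb R^2$ and with time-independent functions on $\mathbb R^3$. Regularity structures. Let $\alpha_{\min}=-1-\kappa$ with $\kappa>0$ small. $T_g$ is the real vector space with basis symbols $\Xi,\ \mathcal I(\Xi)\Xi,\ X_i\Xi$ (spanning $T_{\mathcal W}$) and $1,\ \mathcal I(\Xi),\ X_i$ (spanning $T_{\mathcal U}$), $i=1,2$. $T_g^H$ is the real vector space with basis symbols $\sigma,\ \mathcal I(\sigma)\sigma',\ X_i\sigma$ (spanning $T_{\mathcal W^H}$) and $1,\ \mathcal I(\sigma),\ X_i$ (spanning $T_{\mathcal U^H}$), where $\sigma,\sigma'\in\{\Xi,H\}$, $i=1,2$. Homogeneities: $|1|=0$, $|X_i|=1$, $|\Xi|=|H|=\alpha_{\min}$, $|\tau\bar\tau|=|\tau|+|\bar\tau|$, $|\mathcal I(\tau)|=|\tau|+2$. Let $S=\{\Xi\}$ for $T_g$ and $S=\{\Xi,H\}$ for $T_g^H$. $T_g^+$ (resp. $(T_g^H)^+$) is the commutative algebra generated by $X_1,X_2,\mathcal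 J(\sigma)$, $\sigma\in S$. The structure group consists of the maps $\Gamma_f$, with $f$ a multiplicative linear functional on this algebra, given by $\Gamma_f\sigma=\sigma$, $\Gamma_f1=1$, $\Gamma_fX_i=X_i+f(X_i)1$, $\Gamma_f\mathcal I(\sigma)=\mathcal I(\sigma)+f(\mathcal J(\sigma))1$, $\Gamma_f(\tau\sigma)=(\Gamma_f\tau)\sigma$. The resulting regularity structures are $\mathcal T_g$ and $\mathcal T_g^H$. Kernel. The heat kernel on $\mathbb R\times\mathbb R^2$ is written $\bar K=K+K_{sm}$ with $K_{sm}$ smooth and $K$ supported in $\{|x|^2+t\le1\}$, symmetric in $x$, zero for $t\le0$, equal to $\frac1{4\pi t}e^{-|x|^2/(4t)}$ for $t>0$, $|x|^2+t<\frac12$, smooth on $\{|x|^2+t\ge\frac14\}$, and annihilating polynomials of parabolic degree less than $3$. Admissible models. An admissible model on $\mathcal T_g$ (resp. $\mathcal T_g^H$), with $T=T_g$ (resp. $T_g^H$), is a pair $Z=(\Pi,\Gamma)$, also written $(\Pi,f)$, where $\Pi:\mathbb R^3\to\mathcal L(T,\mathcal S'(\mathbb R^3))$, $\Gamma_{zz'}=(\Gamma_{f_z})^{-1}\Gamma_{f_{z'}}$, $\Pi_z\Gamma_{zz'}=\Pi_{z'}$; for each compact $D$, $|\langle\Pi_z\tau,\varphi_z^\lambda\rangle|\lesssim\lambda^{|\tau|}$ and $\|\Gamma_{zz'}\tau\|_m\lesssim|z-z'|^{|\tau|-m}$ uniformly over basis symbols $\tau$, homogeneities $m<|\tau|$,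 $z,z'\in D$, $\varphi\in\mathcal B$, $\lambda\in(0,1]$ ($\|\cdot\|_m$ is the norm of the component of homogeneity $m$); and, for $z=(t,x)$, $\sigma\in S$: $\Pi_z1=1$, $\Pi_zX_i=(\cdot-x)_i$, $\Pi_z(X_i\sigma)=(\cdot-x)_i\,\Pi_z\sigma$, $\Pi_z\mathcal I(\sigma)(w)=\langle\Pi_z\sigma,K(w-\cdot)\rangle+f_z(\mathcal J(\sigma))$, with $f_z(X_i)=-x_i$ and $f_z(\mathcal J(\sigma))=-\langle\Pi_z\sigma,K(z-\cdot)\rangle$. All models are $2\pi$-periodic in space. A model is smooth if $z\mapsto\Pi_z$ is a smooth map with values in $\mathcal L(T,C^\infty(\mathbb R^3))$. $\mathcal M(\mathcal T)$ is the closure of the smooth admissible models on $\mathcal T$ under the semidistances $\sup_{z\in D}\sup_{\varphi\in\mathcal B}\sup_{\lambda\in(0,1]}\sup_\tau\lambda^{-|\tau|}|\langle\Pi_z\tau-\bar\Pi_z\tau,\varphi_z^\lambda\rangle|$, where $\tau$ runs over basis symbols and $D=I\times\mathbb T^2$ with $I$ a compact interval. Extension. For $Z=(\Pi,f)\in\mathcal M(\mathcal T_g)$ and $h\in L^2(\mathbb T^2)$, $E_hZ=(\Pi^{e_h},f^{e_h})\in\mathcal M(\mathcal T_g^H)$ is the unique admissible model on $\mathcal T_g^H$ that agrees with $Z$ on $T_g$ and $T_g^+$, with $\Pi_z^{e_h}H=h$ and $\Pi_z^{e_h}(\tau_1\sigma)=(\Pi_z^{e_h}\tau_1)(\Pi_z^{e_h}\sigma)$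 for all basis symbols $\tau_1\sigma\in T_g^H\setminus T_g$ of negative homogeneity with $\tau_1\in T_{\mathcal U^H}$, $\sigma\in\{\Xi,H\}$ (product understood as continuous extension of the pointwise product to the Hölder--Sobolev setting). Renormalization maps. For $C\in\mathbb R$, $M=M(C)$ is the linear map on $T_{\mathcal W}\oplus\langle1\rangle$ with $M(\mathcal I(\Xi)\Xi)=\mathcal I(\Xi)\Xi-C\,1$ and $M\tau=\tau$ for the other basis symbols. $M^H=M^H(C)$ is the linear map on $T_{\mathcal W^H}\oplus\langle1\rangle$ that equals $M(C)$ on $T_{\mathcal W}\oplus\langle1\rangle$ and fixes all basis symbols containing $H$. For $Z=(\Pi,\Gamma)\in\mathcal M(\mathcal T_g)$, $M(Z)$ is the unique element of $\mathcal M(\mathcal T_g)$ given on $T_{\mathcal W}\oplus\langle1\rangle$ by $\Pi_z^M\tau=\Pi_zM\tau$, $\Gamma^M_{zz'}\tau=\Gamma_{zz'}\tau$. *)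

(* Defs.v *)
From HB Require Import structures.
From mathcomp Require Import all_boot all_order all_algebra.
From mathcomp Require Import all_classical all_reals all_analysis.
Set Implicit Arguments.
Unset Strict Implicit.
Unset Printing Implicit Defensive.
Import Order.TTheory GRing.Theory Num.Theory numFieldNormedType.Exports.
Local Open Scope classical_set_scope.
Local Open Scope ring_scope.

Section Space.
Variable R : realType.

(* Points of R^3 are z = (t, x), t = z.1 and x = z.2.  The library norms on
   these products are sup norms; they are only used for their topology. *)
Definition crd (i : 'I_2) (x : R * R) : R := if i == 0 then x.1 else x.2.
Definition sqn (x : R * R) : R := x.1 ^+ 2 + x.2 ^+ 2.
Definition pnorm (z : R * (R * R)) : R := Num.sqrt `|z.1| + Num.sqrt (sqn z.2).

Definition basis2 (i : 'I_2) : R * R := ((i == 0)%:R, (i != 0)%:R).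
Definition basis3 (i : 'I_3) : R * (R * R) :=
  ((i == 0)%:R, ((i == 1)%:R, (i == 2%:R)%:R)).

Definition mu2 : {measure set (measurableTypeR R * measurableTypeR R) -> \bar R}
  := (@lebesgue_measure R \x @lebesgue_measure R)%E.
Definition mu3 : {measure set (measurableTypeR R *
    (measurableTypeR R * measurableTypeR R)) -> \bar R}
  := (@lebesgue_measure R \x^ mu2)%E.

Definition rescale (phi : R * (R * R) -> R) (z : R * (R * R)) (lambda : R)
    (w : R * (R * R)) : R :=
  lambda ^- 4 * phi (lambda ^- 2 * (w.1 - z.1),
                     (lambda^-1 * (w.2.1 - z.2.1), lambda^-1 * (w.2.2 - z.2.2))).

Section Smooth.
Variable V : normedModType R.

Definition iter_derive (l : seq V) (f : V -> R) : V -> R :=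
  foldr (fun v g => 'D_v g) f l.

(* All iterated directional derivatives exist and are continuous. *)
Definition smooth_on (A : set V) (f : V -> R) : Prop :=
  forall (l : seq V) z, A z ->
    (forall v, derivable (iter_derive l f) z v) /\ {for z, continuous (iter_derive l f)}.

Definition smooth (f : V -> R) : Prop := smooth_on setT f.

Definition C2 (f : V -> R) : Prop :=
  (forall (l : seq V), (size l <= 2)%N -> continuous (iter_derive l f)) /\
  (forall (l : seq V) z v, (size l < 2)%N -> derivable (iter_derive l f) z v).

Definition compact_supp (f : V -> R) : Prop :=
  exists2 D : set V, compact D & forall z, ~ D z -> f z = 0.

End Smooth.

Definition partial3 (l : seq 'I_3) (f : R * (R * R) -> R) : R * (R * R) -> R :=
  iter_derive [seq basis3 i | i <- l] f.
Definition partial2 (l : seq 'I_2) (f : R * R -> R) : R * R -> R :=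
  iter_derive [seq basis2 i | i <- l] f.

(* The set B of normalised C^2 test functions; the C^2 norm is the maximum of
   the sup norms of the partial derivatives of order at most 2. *)
Definition unit_C2 (phi : R * (R * R) -> R) : Prop :=
  [/\ C2 phi, forall z, phi z != 0 -> pnorm z <= 1
    & forall (l : seq 'I_3) z, (size l <= 2)%N -> `|partial3 l phi z| <= 1].

(* Tempered distributions are identified with their restrictions to the dense
   subspace C_c^oo of the Schwartz space: S' is the space of linear functionals
   on C_c^oo that are continuous for the Schwartz seminorms. *)
Definition testfn : Type :=
  {f : R * (R * R) -> R | smooth f /\ compact_supp f}.

Definition fn (phi : testfn) : R * (R * R) -> R := sval phi.

Definition distr : Type := testfn -> R^o.
HB.instance Definition _ := GRing.Lmodule.on distr.

(* The pairing with a function not known by its type to be in C_c^oo; it has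
   the junk value 0 outside C_c^oo. *)
Definition pairing (u : distr) (f : R * (R * R) -> R) : R :=
  if pselect (smooth f /\ compact_supp f) is left H then u (exist _ f H) else 0.

Definition tempered (u : distr) : Prop :=
  (forall (a : R) (phi psi : testfn),
     pairing u (fun z => a * fn phi z + fn psi z) = a * u phi + u psi) /\
  exists (N : nat) (C : R), forall (phi : testfn) (B : R),
    (forall (l : seq 'I_3) z, (size l <= N)%N ->
       (1 + `|z|) ^+ N * `|partial3 l (fn phi) z| <= B) ->
    `|u phi| <= C * B.

Definition is_fun (u : distr) (g : R * (R * R) -> R) : Prop :=
  forall phi : testfn,
    mu3.-integrable setT (fun z => (g z * fn phi z)%:E) /\
    u phi = \int[mu3]_z (g z * fn phi z).

(* pairC2 u phi c: the pairing of u with the compactly supported C^2 function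
   phi, understood by continuous extension from C_c^oo, is c. *)
Definition pairC2 (u : distr) (phi : R * (R * R) -> R) (c : R) : Prop :=
  forall (phin : nat -> testfn) (D : set (R * (R * R))),
    compact D -> (forall n z, ~ D z -> fn (phin n) z = 0) ->
    (forall (l : seq 'I_3) (e : R), (size l <= 2)%N -> 0 < e ->
       \forall n \near \oo, forall z,
         `|partial3 l (fn (phin n)) z - partial3 l phi z| < e) ->
    u (phin n) @[n --> \oo] --> c.

(* Convergence in the Frechet space C^oo(R^3). *)
Definition cvg_Coo (I : Type) (F : set_system I) (u : I -> R * (R * R) -> R)
    (v : R * (R * R) -> R) : Prop :=
  forall (l : seq (R * (R * R))%type) (D : set (R * (R * R))) (e : R),
    compact D -> 0 < e ->
    \forall i \near F, forall z, D z -> `|iter_derive l (u i) z - iter_derive l v z| < e.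

(* U : R^3 -> C^oo(R^3) is of class C^k. *)
Fixpoint Ck_map (k : nat) (U : R * (R * R) -> R * (R * R) -> R) : Prop :=
  [/\ forall z, smooth (U z), forall z, cvg_Coo (nbhs z) U (U z)
    & if k is k'.+1 then
        forall v, exists2 U', Ck_map k' U' & forall z,
          cvg_Coo (0 : R)^'
            (fun (s : R) w => s^-1 * (U (z + s *: v) w - U z w)) (U' z)
      else True].

Definition smooth_map (U : R * (R * R) -> R * (R * R) -> R) : Prop :=
  forall k, Ck_map k U.

(* Functions on the torus are 2 pi-periodic functions on R^2. *)
Definition periodicT2 (v : R * R -> R) : Prop :=
  forall i x, v (x + (2 * pi) *: basis2 i) = v x.

Definition cell : set (R * R) := `[0, 2 * pi] `*` `[0, 2 * pi].

Definition sqL2 (v : R * R -> R) : \bar R :=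
  (\int[mu2]_(x in cell) ((v x) ^+ 2)%:E)%E.

Definition L2T2 (v : R * R -> R) : Prop :=
  [/\ measurable_fun [set: measurableTypeR R * measurableTypeR R]
        (v : measurableTypeR R * measurableTypeR R -> measurableTypeR R),
      periodicT2 v & (sqL2 v < +oo)%E].

(* v_n -> v in H^beta(T^2), v_n smooth, beta a nonnegative integer; H^beta is
   the completion of the smooth functions for the H^beta norm. *)
Definition sobolev_cvg (beta : nat) (vn : nat -> R * R -> R) (v : R * R -> R)
    : Prop :=
  [/\ forall n, smooth (vn n) /\ periodicT2 (vn n),
      sqL2 (fun x => (vn n x - v x)%R) @[n --> \oo] --> 0%E
    & forall (l : seq 'I_2) (e : R), (size l <= beta)%N -> 0 < e ->
        exists N : nat, forall m n : nat, (N <= m)%N -> (N <= n)%N ->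
          (sqL2 (fun x => (partial2 l (vn m) x - partial2 l (vn n) x)%R) < e%:E)%E].

(* p is the product of the distribution u with q, where q is a (time
   independent) element of H^beta(T^2): the value at q of the continuous
   extension to H^beta(T^2) of v |-> v u, v smooth. *)
Definition sobolev_product (beta : nat) (u q p : distr) : Prop :=
  (exists (v : R * R -> R) (vn : nat -> R * R -> R),
     [/\ L2T2 v, is_fun q (fun z => v z.2) & sobolev_cvg beta vn v]) /\
  (forall (v : R * R -> R) (vn : nat -> R * R -> R),
     L2T2 v -> is_fun q (fun z => v z.2) -> sobolev_cvg beta vn v ->
     forall phi : testfn,
       pairing u (fun z => vn n z.2 * fn phi z) @[n --> \oo] --> p phi).

Definition heat (z : R * (R * R)) : R :=
  if 0 < z.1 then (4 * pi * z.1)^-1 * expR (- (sqn z.2 / (4 * z.1))) else 0.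

Record heat_truncation (K : R * (R * R) -> R) : Prop := HeatTruncation {
  ht_rem : smooth (fun z => heat z - K z);
  ht_supp : forall z, K z != 0 -> sqn z.2 + z.1 <= 1;
  ht_sym : forall t x, K (t, - x) = K (t, x);
  ht_past : forall z, z.1 <= 0 -> K z = 0;
  ht_heat : forall z, 0 < z.1 -> sqn z.2 + z.1 < 2^-1 -> K z = heat z;
  ht_smooth : smooth_on [set z | 4^-1 <= sqn z.2 + z.1] K;
  ht_poly : forall a b c : nat, (2 * a + b + c < 3)%N ->
    \int[mu3]_z (K z * (z.1 ^+ a * z.2.1 ^+ b * z.2.2 ^+ c)) = 0
}.

(* <u, K(w - .)>: K is singular at 0, so the pairing is the limit of the
   pairings with the smooth kernels obtained by cutting out the singularity;
   the limit does not depend on the cutoff. *)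
Definition convK (K : R * (R * R) -> R) (u : distr) (w : R * (R * R)) : R :=
  get [set c : R | forall chi : testfn, (\forall y \near (0 : R * (R * R)), fn chi y = 1) ->
    pairing u (fun y => let k := w - y in
      (1 - fn chi (d ^- 2 * k.1, (d^-1 * k.2.1, d^-1 * k.2.2))) * K k)
      @[d --> 0^'+] --> c].

End Space.

(* Symbols over a set S of noises: symW are the symbols of T_W (the noise s,
   I(s)s', X_i s), symU those of T_U (1, I(s), X_i). *)
Inductive symW (S : Type) :=
  | Noise of S
  | INoise of S & S
  | XNoise of 'I_2 & S.
Inductive symU (S : Type) :=
  | One
  | Int of S
  | Xsym of 'I_2.
Arguments One {S}.
Arguments Xsym {S} _.

Section FinSym.
Variable S : finType.

Definition symW_code (t : symW S) : S + (S * S) + ('I_2 * S) :=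
  match t with
  | Noise s => inl (inl s)
  | INoise s s' => inl (inr (s, s'))
  | XNoise i s => inr (i, s)
  end.
Definition symW_decode (c : S + (S * S) + ('I_2 * S)) : symW S :=
  match c with
  | inl (inl s) => Noise s
  | inl (inr (s, s')) => INoise s s'
  | inr (i, s) => XNoise i s
  end.
Lemma symW_codeK : cancel symW_code symW_decode. Proof. by case. Qed.
HB.instance Definition _ := Finite.copy (symW S) (can_type symW_codeK).

Definition symU_code (t : symU S) : unit + S + 'I_2 :=
  match t with
  | One => inl (inl tt)
  | Int s => inl (inr s)
  | Xsym i => inr i
  end.
Definition symU_decode (c : unit + S + 'I_2) : symU S :=
  match c with
  | inl (inl _) => One
  | inl (inr s) => Int s
  | inr i => Xsym i
  end.
Lemma symU_codeK : cancel symU_code symU_decode. Proof. by case. Qed.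
HB.instance Definition _ := Finite.copy (symU S) (can_type symU_codeK).

End FinSym.

Definition sym (S : Type) : Type := (symW S + symU S)%type.
HB.instance Definition _ (S : finType) := Finite.on (sym S).

(* The basis of T_W (+) <1>; None is the symbol 1. *)
Definition symW1 (S : Type) : Type := option (symW S).
HB.instance Definition _ (S : finType) := Finite.on (symW1 S).

Definition embW1 {S : Type} (t : symW1 S) : sym S :=
  if t is Some t' then inl t' else inr One.

(* The product of a symbol of T_U with a noise. *)
Definition mulN {S : Type} (t : symU S) (s : S) : symW S :=
  match t with
  | One => Noise s
  | Int s' => INoise s' s
  | Xsym i => XNoise i s
  end.

(* The generators of T^+; J s stands for the generator written with a
   calligraphic J. *)
Inductive gen (S : Type) :=
  | GX of 'I_2
  | J of S.
Arguments GX {S} _.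

Section Structure.
Variables (R : realType) (S : finType).

(* The real vector space with basis B. *)
Definition freeMod (B : finType) : Type := {ffun B -> R^o}.
HB.instance Definition _ (B : finType) := GRing.Lmodule.on (freeMod B).

Definition vec {B : finType} (b : B) : freeMod B := [ffun b' => (b' == b)%:R].

(* Linear extension of a map given on the basis. *)
Definition lext {B : finType} {W : lmodType R} (F : B -> W) (v : freeMod B) : W :=
  \sum_(b : B) (v : {ffun B -> R^o}) b *: F b.

Definition T : Type := freeMod (sym S).
HB.instance Definition _ := GRing.Lmodule.on T.

Definition TW1 : Type := freeMod (symW1 S).
HB.instance Definition _ := GRing.Lmodule.on TW1.

Definition bas (t : sym S) : T := vec t.

Definition inclW1 : TW1 -> T := lext (fun t => bas (embW1 t)).

Variable kappa : R.
Definition alpha_min : R := - 1 - kappa.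

Definition homU (t : symU S) : R :=
  match t with One => 0 | Int _ => alpha_min + 2 | Xsym _ => 1 end.
Definition homW (t : symW S) : R :=
  match t with
  | Noise _ => alpha_min
  | INoise _ _ => (alpha_min + 2) + alpha_min
  | XNoise _ _ => 1 + alpha_min
  end.
Definition hom (t : sym S) : R :=
  match t with inl t' => homW t' | inr t' => homU t' end.

(* The norm of the component of homogeneity m. *)
Definition norm_at (m : R) (v : T) : R :=
  \sum_(t : sym S | hom t == m) `|(v : {ffun sym S -> R^o}) t|.

(* Since T^+ is the free commutative algebra on gen S, a multiplicative linear
   functional f on it is given by its values on the generators. *)
Definition GammaU (f : gen S -> R) (t : symU S) : freeMod (symU S) :=
  match t with
  | One => vec One
  | Int s => vec (Int s) + f (J s) *: vec One
  | Xsym i => vec (Xsym i) + f (GX i) *: vec One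
  end.

Definition inclU : freeMod (symU S) -> T := lext (fun t => bas (inr t)).
Definition rmulN (s : S) : freeMod (symU S) -> T :=
  lext (fun t => bas (inl (mulN t s))).

Definition Gamma_sym (f : gen S -> R) (t : sym S) : T :=
  match t with
  | inl (Noise s) => bas (inl (Noise s))
  | inl (INoise s' s) => rmulN s (GammaU f (Int s'))
  | inl (XNoise i s) => rmulN s (GammaU f (Xsym i))
  | inr t' => inclU (GammaU f t')
  end.

Definition Gamma (f : gen S -> R) : T -> T := lext (Gamma_sym f).

(* The inverse of Gamma f, see GammaK and GammaVK. *)
Definition GammaV (f : gen S -> R) : T -> T := Gamma (fun g => - f g).

End Structure.

Section GammaInverse.
Variables (R : realType) (S : finType).

Lemma lext_linear (B : finType) (W : lmodType R) (F : B -> W) :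
  linear (lext F : freeMod R B -> W).
Proof.
move=> a u v; rewrite /lext scaler_sumr -big_split /=; apply: eq_bigr => b _.
by rewrite !ffunE scalerDl scalerA.
Qed.

Lemma lextD (B : finType) (W : lmodType R) (F : B -> W) (u v : freeMod R B) :
  lext F (u + v) = lext F u + lext F v.
Proof. by rewrite -[u]scale1r lext_linear !scale1r. Qed.

Lemma lextZ (B : finType) (W : lmodType R) (F : B -> W) a (v : freeMod R B) :
  lext F (a *: v) = a *: lext F v.
Proof.
rewrite /lext scaler_sumr; apply: eq_bigr => b _.
by rewrite !ffunE scalerA.
Qed.

Lemma lext_vec (B : finType) (W : lmodType R) (F : B -> W) (b : B) :
  lext F (vec R b) = F b.
Proof.
rewrite /lext (bigD1 b) //= ffunE eqxx scale1r big1 ?addr0 // => b' b'b.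
by rewrite ffunE (negbTE b'b) scale0r.
Qed.

Lemma lext_sum (B : finType) (I : finType) (W : lmodType R) (F : B -> W)
    (u : I -> freeMod R B) :
  lext F (\sum_i u i) = \sum_i lext F (u i).
Proof.
apply: (big_morph (lext F)) => [x y|]; first exact: lextD.
by rewrite -[0](scale0r 0) lextZ scale0r.
Qed.

Lemma free_sum (B : finType) (v : freeMod R B) :
  v = \sum_b (v : {ffun B -> R^o}) b *: vec R b.
Proof.
apply/ffunP => b; rewrite sum_ffunE (bigD1 b) //= big1 ?addr0.
  by rewrite !ffunE eqxx /GRing.scale /= mulr1.
by move=> b' b'b; rewrite !ffunE eq_sym (negbTE b'b) scaler0.
Qed.

Lemma GammaK_ (f g : gen S -> R) : (forall x, g x = - f x) ->
  forall v : T R S, Gamma g (Gamma f v) = v.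
Proof.
move=> gf v; rewrite {2}[v]free_sum {2}/Gamma {1}/lext /Gamma lext_sum.
apply: eq_bigr => t _; rewrite lextZ; congr (_ *: _).
case: t => [[s|s' s|i s]|[|s|i]] /=;
  rewrite /rmulN /inclU ?lextD ?lextZ ?lext_vec //= /rmulN /inclU.
all: rewrite ?lextD ?lextZ ?lext_vec //= /rmulN /inclU ?lext_vec //=.
all: by rewrite -addrA -scalerDl gf addNr scale0r addr0.
Qed.

Lemma GammaK (f : gen S -> R) : cancel (@Gamma R S f) (GammaV f).
Proof. exact: GammaK_. Qed.

Lemma GammaVK (f : gen S -> R) : cancel (GammaV f) (@Gamma R S f).
Proof. by apply: GammaK_ => x; rewrite opprK. Qed.

End GammaInverse.

Section Models.
Variables (R : realType) (kappa : R) (K : R * (R * R) -> R).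

(* Gamma is a function of f, see Gam. *)
Record model (S : finType) : Type := Model {
  Pi : R * (R * R) -> T R S -> distr R;
  chr : R * (R * R) -> gen S -> R
}.

Definition Gam (S : finType) (Z : model S) (z z' : R * (R * R)) : T R S -> T R S :=
  GammaV (chr Z z) \o Gamma (chr Z z').

Definition shift (i : 'I_2) (z : R * (R * R)) : R * (R * R) :=
  (z.1, z.2 + (2 * pi) *: basis2 R i).

Record admissible (S : finType) (Z : model S) : Prop := Admissible {
  adm_linear : forall z, linear (Pi Z z);
  adm_tempered : forall z v, tempered (Pi Z z v);
  adm_Gam : forall z z' v, Pi Z z (Gam Z z z' v) = Pi Z z' v;
  adm_Pi_bound : forall D : set (R * (R * R)), compact D -> exists C : R,
    forall (t : sym S) z phi (lambda : R), D z -> unit_C2 phi ->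
      0 < lambda <= 1 ->
      exists2 c, pairC2 (Pi Z z (bas R t)) (rescale phi z lambda) c
               & `|c| <= C * lambda `^ hom kappa t;
  adm_Gam_bound : forall D : set (R * (R * R)), compact D -> exists C : R,
    forall (t t' : sym S) z z', D z -> D z' -> hom kappa t' < hom kappa t ->
      norm_at kappa (hom kappa t') (Gam Z z z' (bas R t))
        <= C * pnorm (z - z') `^ (hom kappa t - hom kappa t');
  adm_one : forall z, is_fun (Pi Z z (bas R (inr One))) (fun=> 1);
  adm_X : forall z i, is_fun (Pi Z z (bas R (inr (Xsym i))))
    (fun w => crd i (w.2 - z.2));
  adm_XN : forall z i s (phi : testfn R),
    Pi Z z (bas R (inl (XNoise i s))) phi =
    pairing (Pi Z z (bas R (inl (Noise s))))
      (fun w => crd i (w.2 - z.2) * fn phi w);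
  adm_I : forall z s, is_fun (Pi Z z (bas R (inr (Int s))))
    (fun w => convK K (Pi Z z (bas R (inl (Noise s)))) w + chr Z z (J s));
  adm_chr_X : forall z i, chr Z z (GX i) = - crd i z.2;
  adm_chr_J : forall z s,
    chr Z z (J s) = - convK K (Pi Z z (bas R (inl (Noise s)))) z;
  adm_periodic_Pi : forall i z v (phi : testfn R),
    pairing (Pi Z (shift i z) v) (fun w => fn phi (w - shift i 0)) = Pi Z z v phi;
  adm_periodic_Gam : forall i z z',
    Gam Z (shift i z) (shift i z') = Gam Z z z'
}.

Definition smooth_model (S : finType) (Z : model S) : Prop :=
  exists U : R * (R * R) -> T R S -> R * (R * R) -> R,
    [/\ forall z a v v' w, U z (a *: v + v') w = a * U z v w + U z v' w,
        forall v, smooth_map (fun z => U z v)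
      & forall z v, is_fun (Pi Z z v) (U z v)].

(* The semidistance attached to D = [a, b] x T^2. *)
Definition semidist (S : finType) (a b : R) (Z Z' : model S) : \bar R :=
  ereal_sup [set r | exists z phi lambda t c,
    [/\ a <= z.1 <= b, unit_C2 phi, 0 < lambda <= 1,
        pairC2 (Pi Z z (bas R t) - Pi Z' z (bas R t)) (rescale phi z lambda) c
      & r = (lambda `^ (- hom kappa t) * `|c|)%:E]].

Definition inM (S : finType) (Z : model S) : Prop :=
  admissible Z /\
  forall a b eps : R, a <= b -> 0 < eps ->
    exists Z' : model S, [/\ admissible Z', smooth_model Z'
      & (semidist a b Z Z' < eps%:E)%E].

Definition MM (S : finType) : Type := {Z : model S | inM Z}.

(* M(C), xi being the symbol Xi. *)
Definition Mlin (S : finType) (xi : S) (C : R) : TW1 R S -> TW1 R S :=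
  lext (fun t => vec R t - (if t == Some (INoise xi xi) then C else 0) *: vec R None).

Definition renorm_on (S : finType) (xi : S) (C : R) (Z Z' : model S) : Prop :=
  (forall z v, Pi Z' z (inclW1 v) = Pi Z z (inclW1 (Mlin xi C v))) /\
  (forall z z' v, Gam Z' z z' (inclW1 v) = Gam Z z z' (inclW1 v)).

(* Z' is the unique element of M(T) extending the pair defined from Z and M(C)
   on T_W (+) <1>. *)
Definition is_renorm (S : finType) (xi : S) (C : R) (Z Z' : MM S) : Prop :=
  unique (fun Y : MM S => renorm_on xi C (sval Z) (sval Y)) Z'.

(* T_g has the single noise Xi; T_g^H has the noises Xi = Some tt and
   H = None. *)
Definition noise : finType := unit.
Definition noiseH : finType := option unit.
Definition Xi : noise := tt.
Definition XiH : noiseH := Some Xi.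
Definition Hn : noiseH := None.

Definition embW (t : symW noise) : symW noiseH :=
  match t with
  | Noise s => Noise (Some s : noiseH)
  | INoise s s' => INoise (Some s : noiseH) (Some s' : noiseH)
  | XNoise i s => XNoise i (Some s : noiseH)
  end.
Definition embU (t : symU noise) : symU noiseH :=
  match t with
  | One => One
  | Int s => Int (Some s : noiseH)
  | Xsym i => Xsym i
  end.
Definition emb (t : sym noise) : sym noiseH :=
  match t with inl t' => inl (embW t') | inr t' => inr (embU t') end.
Definition embG (g : gen noise) : gen noiseH :=
  match g with GX i => GX i | J s => J (Some s : noiseH) end.

(* T_g as a subspace of T_g^H. *)
Definition inclT : T R noise -> T R noiseH := lext (fun t => bas R (emb t)).

(* In a product containing H one factor is in a Sobolev space on T^2: the
   factor h in L^2 if the noise is H, and otherwise, in I(H)Xi, the factor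
   Pi_z I(H) in H^2. *)
Definition extends (h : R * R -> R) (Z : model noise) (W : model noiseH) : Prop :=
  [/\ forall z v, Pi W z (inclT v) = Pi Z z v,
      forall z g, chr W z (embG g) = chr Z z g,
      forall z, is_fun (Pi W z (bas R (inl (Noise Hn)))) (fun w => h w.2)
    & forall z (t : symU noiseH) (s : noiseH),
        (forall t', mulN t s <> embW t') -> homW kappa (mulN t s) < 0 ->
        let u := Pi W z (bas R (inr t)) in
        let q := Pi W z (bas R (inl (Noise s))) in
        let p := Pi W z (bas R (inl (mulN t s))) in
        if s == Hn then sobolev_product 0 u q p else sobolev_product 2 q u p].

(* W = E_h Z. *)
Definition is_ext (h : R * R -> R) (Z : MM noise) (W : MM noiseH) : Prop :=
  unique (fun Y : model noiseH => admissible Y /\ extends h (sval Z) Y) (sval W).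

End Models.

Definition map_group (X : Type) (G : set (X -> X)) : Prop :=
  [/\ G id, forall f g, G f -> G g -> G (f \o g)
    & forall f, G f -> exists2 g, G g & cancel f g /\ cancel g f].

(* Main.v *)
Require Import Defs.
From HB Require Import structures.
From mathcomp Require Import all_boot all_order all_algebra.
From mathcomp Require Import all_classical all_reals all_analysis.
From mathcomp Require Import lra.
Import Order.TTheory GRing.Theory Num.Theory numFieldNormedType.Exports.
Local Open Scope classical_set_scope.
Local Open Scope ring_scope.

(** Extend M(C) to a linear map [renT] on the whole model space T by the
identity on the other symbols, and let the renormalized model be
[Pi_z \o renT], with the same structure group elements; this is [renorm].

It is again an admissible model. The map [renT] commutes with the structure
group ([renT_Gamma]), so [Pi] and [Gamma] stay compatible. The symbols on which
the admissibility axioms prescribe or relate values of [Pi] (1, X_i, I(s), s,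
X_i s) are all fixed, and the bound on I(Xi)Xi survives because a constant is
bounded by lambda^(- 2 kappa) ([renorm_admissible]). Two models are moved by
the same multiple of Pi_z 1 = 1, so the semidistances do not change
([semidist_renorm]); as smoothness is preserved too, the closure of the smooth
models is mapped to itself. The result is unique since an admissible model is
determined by its values on T_W ([admissible_ext]).

Because 1 is fixed, composing [renT C] and [renT C'] gives [renT (C + C')], so
the maps form a group, the image of the additive group of real numbers.

For the extension by h, the maps M and M^H agree on T_g and M^H fixes every
symbol containing H. So the renormalization of an extension of Z satisfies the
conditions on an extension of M(C)(Z) ([extends_renorm]). Applied to - C, the
same lemma takes any extension of M(C)(Z) back to an extension of Z, and
transports uniqueness from Z to M(C)(Z). *)

(** * Linear maps on free modules *)

Section LinearMaps.
Set Implicit Arguments.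
Unset Strict Implicit.
Variable R : realType.

Lemma linearB_scale (V W : lmodType R) (f : V -> W) :
  linear f -> forall (c : R) u v, f (u - c *: v) = f u - c *: f v.
Proof. by move=> lf c u v; rewrite addrC -scaleNr lf scaleNr addrC. Qed.

Lemma linear_comp (U V W : lmodType R) (f : V -> W) (g : U -> V) :
  linear f -> linear g -> linear (f \o g).
Proof. by move=> lf lg a u v /=; rewrite lg lf. Qed.

Lemma linear_basis_ext (B : finType) (W : lmodType R) (f g : freeMod R B -> W) :
  linear f -> linear g -> (forall b, f (vec R b) = g (vec R b)) -> f = g.
Proof.
move=> lf lg fg; apply/funext => v; rewrite [v]free_sum.
have f0 : f 0 = 0 by rewrite -[0 in LHS](subrr (0 + 0)) -[X in _ - X]scale1r
  (linearB_scale lf) scale1r subrr.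
have g0 : g 0 = 0 by rewrite -[0 in LHS](subrr (0 + 0)) -[X in _ - X]scale1r
  (linearB_scale lg) scale1r subrr.
elim: (index_enum B) => [|b s IHs]; first by rewrite !big_nil f0 g0.
by rewrite !big_cons lf lg IHs fg.
Qed.

(** Both the map M(C) on T_W + <1> and its extension to the whole model space
are of this form: a multiple of one basis vector [e] is subtracted from another
one, [b]. *)
Definition shear (B : finType) (b e : B) (C : R) : freeMod R B -> freeMod R B :=
  lext (fun t => vec R t - (if t == b then C else 0) *: vec R e).

Lemma shear_linear (B : finType) (b e : B) C : linear (shear b e C).
Proof. exact: lext_linear. Qed.

Lemma shear_vec (B : finType) (b e : B) C t : shear b e C (vec R t) =
  vec R t - (if t == b then C else 0) *: vec R e.
Proof. exact: lext_vec. Qed.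

Lemma shear0 (B : finType) (b e : B) v : shear b e 0 v = v.
Proof.
move: v; apply/funeqP; apply: linear_basis_ext => [//|//|t].
- exact: shear_linear.
- by rewrite shear_vec if_same scale0r subr0.
Qed.

(** The shears add up because [e != b]: the subtracted vector is itself
fixed. *)
Lemma shear_comp (B : finType) (b e : B) C C' v : e != b ->
  shear b e C (shear b e C' v) = shear b e (C + C') v.
Proof.
move=> /negbTE eb; move: v; apply/funeqP; apply: linear_basis_ext => [||t].
- exact: (linear_comp (@shear_linear _ b e C) (@shear_linear _ b e C')).
- exact: shear_linear.
rewrite /= shear_vec (linearB_scale (@shear_linear _ b e C)) !shear_vec eb.
by rewrite scale0r subr0 -addrA -opprD -scalerDl; case: ifP; rewrite ?addr0.
Qed.

End LinearMaps.

(** * The renormalization map on the model space *)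

Section RenormalizationMap.
Set Implicit Arguments.
Unset Strict Implicit.
Variables (R : realType) (S : finType) (xi : S).

(** M(C) extended to the whole of T by the identity on the remaining symbols.
The admissibility axioms leave no other choice for the renormalized
model, see [admissible_ext]. *)
Definition renT (C : R) : T R S -> T R S :=
  shear (inl (INoise xi xi) : sym S) (inr One) C.

Lemma renT_linear C : linear (renT C).
Proof. exact: shear_linear. Qed.

Lemma renTDZ C u a v : renT C (u + a *: v) = renT C u + a *: renT C v.
Proof. by rewrite addrC renT_linear addrC. Qed.

Lemma renT_bas C t : renT C (bas R t) =
  bas R t - (if t == inl (INoise xi xi) then C else 0) *: bas R (inr One).
Proof. exact: shear_vec. Qed.

Lemma renT_id C t : t != inl (INoise xi xi) -> renT C (bas R t) = bas R t.
Proof. by move=> /negbTE tN; rewrite renT_bas tN scale0r subr0. Qed.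

Lemma renT_comp C C' v : renT C (renT C' v) = renT (C + C') v.
Proof. exact: shear_comp. Qed.

Lemma renT0 v : renT 0 v = v.
Proof. exact: shear0. Qed.

Lemma renT_inclW1 C v : renT C (inclW1 v) = inclW1 (Mlin xi C v).
Proof.
move: v; apply/funeqP; apply: linear_basis_ext => [||t].
- exact: (linear_comp (@renT_linear C) (lext_linear _)).
- exact: (linear_comp (lext_linear _) (lext_linear _)).
rewrite /inclW1 /Mlin /= !lext_vec renT_bas.
rewrite (linearB_scale (lext_linear _)) !lext_vec /=.
by case: t.
Qed.

(** On I(xi)xi the structure group only produces a multiple of xi, which
[renT] fixes, and [renT] only produces a multiple of 1, which the structure
group fixes. *)
Lemma renT_Gamma C f v : renT C (Gamma f v) = Gamma f (renT C v).
Proof.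
have lG : linear (@Gamma R S f) by exact: lext_linear.
move: v; apply/funeqP; apply: linear_basis_ext => [||t].
- exact: (linear_comp (@renT_linear C) lG).
- exact: (linear_comp lG (@renT_linear C)).
have GE t' : Gamma f (bas R t') = Gamma_sym f t' by exact: lext_vec.
have G1 : Gamma f (bas R (inr One)) = bas R (inr One).
  by rewrite GE /= /inclU lext_vec.
rewrite /= -/(bas R t) renT_bas (linearB_scale lG) G1 GE.
case: t => [[s|s' s|i s]|[|s|i]] /=.
all: rewrite /rmulN /inclU ?lextD ?lextZ ?lext_vec /=.
all: rewrite ?scale0r ?subr0 ?renTDZ.
- exact: renT_id.
- by rewrite renT_bas addrAC; congr (_ + _ *: _ - _); exact: renT_id.
- by congr (_ + _ *: _); exact: renT_id.
- exact: renT_id.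
- by congr (_ + _ *: _); exact: renT_id.
- by congr (_ + _ *: _); exact: renT_id.
Qed.

Lemma Gam_renT C (Z : model R S) z z' v :
  renT C (Gam Z z z' v) = Gam Z z z' (renT C v).
Proof. by rewrite /Gam /= /GammaV !renT_Gamma. Qed.

End RenormalizationMap.

Section Embedding.
Set Implicit Arguments.
Unset Strict Implicit.
Variable R : realType.

Lemma renT_inclT C (v : T R noise) :
  renT XiH C (Defs.inclT v) = Defs.inclT (renT Xi C v).
Proof.
move: v; apply/funeqP; apply: linear_basis_ext => [||t].
- exact: (linear_comp (@renT_linear _ _ _ C) (lext_linear _)).
- exact: (linear_comp (lext_linear _) (@renT_linear _ _ _ C)).
rewrite /Defs.inclT /= lext_vec [in RHS]renT_bas.
rewrite (linearB_scale (lext_linear _)) !lext_vec renT_bas /=.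
by case: t => [[[]|[] []|i []]|[|[]|i]].
Qed.

End Embedding.

(** * Uniqueness and admissibility *)

Section Distributions.
Variable R : realType.
Set Implicit Arguments.
Unset Strict Implicit.

Lemma is_fun_inj (u v : distr R) g : Defs.is_fun u g -> Defs.is_fun v g -> u = v.
Proof. by move=> ug vg; apply/funext => phi; rewrite (ug phi).2 (vg phi).2. Qed.

Lemma pairC2_linear (u v : distr R) phi (a c d : R) :
  pairC2 u phi c -> pairC2 v phi d -> pairC2 (u - a *: v) phi (c - a * d).
Proof.
move=> uc vd phin D cD D0 cphi.
have /= cu := uc phin D cD D0 cphi; have /= cv := vd phin D cD D0 cphi.
by apply: cvgB => //; apply: cvgMr.
Qed.

End Distributions.

Section Uniqueness.
Variables (R : realType) (kappa : R) (K : R * (R * R) -> R) (S : finType).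
Set Implicit Arguments.
Unset Strict Implicit.

(** The axioms prescribe the action of the model on 1 and X_i, and determine
the character, hence also the action on I(s), from the action on the noises.
So a model is determined on T by its restriction to T_W. *)
Lemma admissible_ext (Y Y' : model R S) :
  admissible kappa K Y -> admissible kappa K Y' ->
  (forall z t, Pi Y z (bas R (inl t)) = Pi Y' z (bas R (inl t))) -> Y = Y'.
Proof.
move=> aY aY' YY'.
have chrE : chr Y = chr Y'.
  apply/funext => z; apply/funext => -[i|s].
    by rewrite (adm_chr_X aY) (adm_chr_X aY').
  by rewrite (adm_chr_J aY) (adm_chr_J aY') YY'.
have PiE : Pi Y = Pi Y'.
  apply/funext => z; apply: linear_basis_ext => [||[t|[|s|i]]].
  - exact: (adm_linear aY).
  - exact: (adm_linear aY').
  - exact: YY'.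
  - exact: is_fun_inj (adm_one aY z) (adm_one aY' z).
  - apply: is_fun_inj (adm_I aY z s) _.
    by rewrite YY' chrE; exact: (adm_I aY' z s).
  - exact: is_fun_inj (adm_X aY z i) (adm_X aY' z i).
by case: Y Y' PiE chrE {aY aY' YY'} => [P c] [P' c'] /= -> ->.
Qed.

End Uniqueness.

Section Renormalization.
Variables (R : realType) (kappa : R) (K : R * (R * R) -> R).
Variables (S : finType) (xi : S).
Set Implicit Arguments.
Unset Strict Implicit.

Definition renorm (C : R) (Z : model R S) : model R S :=
  Model (fun z v => Pi Z z (renT xi C v)) (chr Z).

Lemma renorm_comp C C' Z : renorm C (renorm C' Z) = renorm (C + C') Z.
Proof.
rewrite /renorm /=; congr Model; apply/funext => z; apply/funext => v.
by rewrite renT_comp addrC.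
Qed.

Lemma renorm0 Z : renorm 0 Z = Z.
Proof.
case: Z => P f; rewrite /renorm /=; congr Model; apply/funext => z.
by apply/funext => v; rewrite renT0.
Qed.

(** Besides [renT_Gamma], the point is the bound on [Pi]: on I(xi)xi the
counterterm C is of size lambda^0, which is dominated by lambda^|I(xi)xi|
since lambda <= 1 and |I(xi)xi| = - 2 kappa <= 0. *)
Lemma renorm_admissible C Z : 0 <= kappa ->
  admissible kappa K Z -> admissible kappa K (renorm C Z).
Proof.
move=> kappa_ge0 aZ; split=> /=.
- move=> z; exact: (linear_comp (adm_linear aZ z) (@renT_linear _ _ _ C)).
- by move=> z v; exact: (adm_tempered aZ).
- by move=> z z' v; rewrite -(adm_Gam aZ z z') -Gam_renT.
- move=> D cD; have [C0 HC0] := adm_Pi_bound aZ cD.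
  (* The absolute value is there because [C0] may be negative. *)
  exists ((1 + `|C|) * `|C0|) => t z phi lambda Dz uphi l01.
  have [c Pc cle] := HC0 t z phi lambda Dz uphi l01.
  have [d Pd dle] := HC0 (inr One) z phi lambda Dz uphi l01.
  have C0le (x : R) : C0 * lambda `^ x <= `|C0| * lambda `^ x.
    by rewrite ler_wpM2r ?powR_ge0 // ler_norm.
  rewrite renT_bas (linearB_scale (adm_linear aZ z)).
  set k := if _ then C else 0.
  exists (c - k * d); first exact: pairC2_linear.
  rewrite mulrDl mul1r mulrDl -mulrA.
  apply: le_trans (ler_normB _ _) _; apply: lerD.
    exact: le_trans cle (C0le _).
  rewrite normrM /k; case: eqP => [->|_]; last first.
    by rewrite normr0 mul0r !mulr_ge0 ?powR_ge0.
  apply: ler_wpM2l => //; apply: le_trans (le_trans dle (C0le _)) _.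
  apply: ler_wpM2l => //; apply: ger_powR => //=.
  by rewrite /alpha_min; move: kappa_ge0; lra.
- by move=> D cD; exact: (adm_Gam_bound aZ cD).
- by move=> z; rewrite renT_id //; exact: (adm_one aZ).
- by move=> z i; rewrite renT_id //; exact: (adm_X aZ).
- move=> z i s phi.
  transitivity (Pi Z z (bas R (inl (XNoise i s))) phi).
    by congr (Pi Z z _ phi); exact: renT_id.
  by rewrite (adm_XN aZ); congr (pairing (Pi Z z _) _); exact/esym/renT_id.
- move=> z s.
  have -> : convK K (Pi Z z (renT xi C (bas R (inl (Noise s))))) =
      convK K (Pi Z z (bas R (inl (Noise s)))).
    by congr (convK K (Pi Z z _)); exact: renT_id.
  have := adm_I aZ z s; congr (Defs.is_fun (Pi Z z _) _); exact/esym/renT_id.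
- by move=> z i; exact: (adm_chr_X aZ).
- by move=> z s; rewrite renT_id //; exact: (adm_chr_J aZ).
- by move=> i z v phi; exact: (adm_periodic_Pi aZ).
- by move=> i z z'; exact: (adm_periodic_Gam aZ).
Qed.

Lemma renorm_smooth C Z : smooth_model Z -> smooth_model (renorm C Z).
Proof.
move=> [U [Ulin Usm UZ]]; exists (fun z v => U z (renT xi C v)); split => //=.
by move=> z a v v' w; rewrite renT_linear Ulin.
Qed.

(** The counterterm C is the same for both models, so it cancels in their
difference: renormalization is an isometry, which is why it preserves the
closure of the smooth models. *)
Lemma semidist_renorm C Z Z' a b :
  admissible kappa K Z -> admissible kappa K Z' ->
  semidist kappa a b (renorm C Z) (renorm C Z') = semidist kappa a b Z Z'.
Proof.
move=> aZ aZ'.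
have PiB z t : Pi (renorm C Z) z (bas R t) - Pi (renorm C Z') z (bas R t) =
    Pi Z z (bas R t) - Pi Z' z (bas R t).
  rewrite /= renT_bas (linearB_scale (adm_linear aZ z)).
  rewrite (linearB_scale (adm_linear aZ' z)).
  rewrite (is_fun_inj (adm_one aZ z) (adm_one aZ' z)).
  by rewrite opprB addrA subrK.
rewrite /semidist; congr ereal_sup; apply/seteqP; split => r /=.
  move=> [z [phi [l [t [c]]]]]; rewrite PiB => H.
  by exists z, phi, l, t, c.
move=> [z [phi [l [t [c]]]]]; rewrite -PiB => H.
by exists z, phi, l, t, c.
Qed.

Lemma renorm_inM C Z : 0 <= kappa -> inM kappa K Z -> inM kappa K (renorm C Z).
Proof.
move=> kge0 [aZ approx]; split; first exact: renorm_admissible.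
move=> a b e ab e0; have [Z' [aZ' sZ' ZZ']] := approx a b e ab e0.
exists (renorm C Z'); split; first exact: renorm_admissible.
  exact: renorm_smooth.
by rewrite semidist_renorm.
Qed.

Definition renormMM (kge0 : 0 <= kappa) (C : R) (Z : MM kappa K S) : MM kappa K S :=
  exist _ (renorm C (sval Z)) (renorm_inM C kge0 (svalP Z)).

Lemma MM_inj (Z Z' : MM kappa K S) : sval Z = sval Z' -> Z = Z'.
Proof.
case: Z Z' => [Z pZ] [Z' pZ'] /= E.
by move: pZ pZ'; rewrite E => pZ pZ'; rewrite (Prop_irrelevance pZ pZ').
Qed.

Lemma renormMM_comp kge0 C C' Z :
  renormMM kge0 C (renormMM kge0 C' Z) = renormMM kge0 (C + C') Z.
Proof. by apply: MM_inj; exact: renorm_comp. Qed.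

Lemma renormMM0 kge0 Z : renormMM kge0 0 Z = Z.
Proof. by apply: MM_inj; exact: renorm0. Qed.

Lemma renormMM_is_renorm kge0 C Z : is_renorm xi C Z (renormMM kge0 C Z).
Proof.
have renE : renorm_on xi C (sval Z) (renorm C (sval Z)).
  by split=> [z v|z z' v] //=; rewrite renT_inclW1.
split=> // Y [YPi YGam]; apply: MM_inj; apply: admissible_ext.
- exact: (svalP (renormMM kge0 C Z)).1.
- exact: (svalP Y).1.
move=> z t.
have <- : inclW1 (vec R (Some t)) = bas R (inl t) by exact: lext_vec.
by rewrite YPi renE.1.
Qed.

End Renormalization.

(** * Group structure and extension *)

Section Groups.
Set Implicit Arguments.
Unset Strict Implicit.
Variable R : realType.

Lemma map_group_additive (X : Type) (F : R -> X -> X) :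
  (forall x, F 0 x = x) -> (forall C C' x, F C (F C' x) = F (C + C') x) ->
  map_group (range F).
Proof.
move=> F0 FD; split.
- by exists 0 => //; apply/funext => x; rewrite F0.
- move=> _ _ [C _ <-] [C' _ <-]; exists (C + C') => //.
  by apply/funext => x /=; rewrite FD.
- move=> _ [C _ <-]; exists (F (- C)); first by exists (- C).
  by split=> x; rewrite FD ?addNr ?addrN F0.
Qed.

Lemma Mlin0 (S : finType) (xi : S) (v : TW1 R S) : Mlin xi 0 v = v.
Proof. exact: shear0. Qed.

Lemma Mlin_comp (S : finType) (xi : S) C C' (v : TW1 R S) :
  Mlin xi C (Mlin xi C' v) = Mlin xi (C + C') v.
Proof. exact: (@shear_comp R (symW1 S) (Some (INoise xi xi)) None). Qed.

End Groups.

Section Extension.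
Variables (R : realType) (kappa : R) (h : R * R -> R).
Set Implicit Arguments.
Unset Strict Implicit.

(** The conditions that characterize the extension concern T_g, where the two
renormalization maps agree, and the symbols other than I(Xi)Xi, which M^H
fixes. *)
Lemma extends_renorm C (Z : model R noise) (W : model R noiseH) :
  extends kappa h Z W -> extends kappa h (renorm Xi C Z) (renorm XiH C W).
Proof.
move=> [PiW chrW PiH prodW]; split => //=.
- by move=> z v; rewrite renT_inclT PiW.
- by move=> z; rewrite renT_id.
move=> z t s tsH hom_ts /=.
have tsN : inl (mulN t s) != inl (INoise XiH XiH) :> sym noiseH.
  by apply/eqP => -[E]; exact: (tsH (INoise Xi Xi)).
by rewrite !renT_id //; exact: prodW.
Qed.

End Extension.

Theorem proposition3p18 (R : realType) (kappa : R) (kappa01 : 0 < kappa < 1)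
  (K : R * (R * R) -> R) (hK : heat_truncation K)
  (h : R * R -> R) (hh : L2T2 h) :
  exists (Mg : R -> MM kappa K noise -> MM kappa K noise)
         (MH : R -> MM kappa K noiseH -> MM kappa K noiseH),
    [/\ forall (C : R) (Z : MM kappa K noise), is_renorm Xi C Z (Mg C Z),
        forall (C : R) (Z : MM kappa K noiseH), is_renorm XiH C Z (MH C Z),
        map_group (range MH),
        map_group (range (fun C : R => @Mlin R noiseH XiH C))
      & forall (C : R) (Z : MM kappa K noise) (EhZ : MM kappa K noiseH),
          is_ext h Z EhZ ->
          admissible kappa K (sval (MH C EhZ)) /\
          is_ext h (Mg C Z) (MH C EhZ)].
Proof.
have kge0 : 0 <= kappa by case/andP: kappa01 => /ltW.
exists (renormMM Xi kge0), (renormMM XiH kge0); split.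
- exact: renormMM_is_renorm.
- exact: renormMM_is_renorm.
- apply: map_group_additive; first exact: renormMM0.
  exact: renormMM_comp.
- apply: map_group_additive; first exact: Mlin0.
  exact: Mlin_comp.
move=> C Z EhZ [[aE extE] uniqE]; split.
  exact: (svalP (renormMM XiH kge0 C EhZ)).1.
split=> [|Y [aY extY]].
  by split; [exact: renorm_admissible | exact: extends_renorm].
(* Undoing the renormalization of [Y] gives an extension of [Z], so uniqueness
   of the extension of [Z] identifies it with [EhZ]. *)
have -> : Y = renorm XiH C (renorm XiH (- C) Y).
  by rewrite renorm_comp addrN renorm0.
rewrite /=; congr renorm; apply: uniqE; split; first exact: renorm_admissible.
by have := extends_renorm (- C) extY; rewrite renorm_comp addNr renorm0.
Qed.
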